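(* The function $\mathrm{ent}(s,t)$ is strictly concave on $\{(s,t)\in\mathbb{R}^2:|s|+|t|\le2\}$.
   Context: For $(s,t)$ with $|s|+|t|\le2$ set $p_a=\frac t4+\frac1{2\pi}\arccos\!\big(\tfrac{\cos(\pi t/2)-\cos(\pi s/2)}2\big)$, $p_b=-\frac t4+\frac1{2\pi}\arccos\!\big(\tfrac{\cos(\pi t/2)-\cos(\pi s/2)}2\big)$, $p_c=-\frac s4+\frac1{2\pi}\arccos\!\big(\tfrac{\cos(\pi s/2)-\cos(\pi t/2)}2\big)$, $p_d=\frac s4+\frac1{2\pi}\arccos\!\big(\tfrac{\cos(\pi s/2)-\cos(\pi t/2)}2\big)$, with $\arccos\in[0,\pi]$. Define $\mathrm{ent}(s,t)=\frac1\pi\big(L(\pi p_a)+L(\pi p_b)+L(\pi p_c)+L(\pi p_d)\big)$, where $L(z)=-\int_0^z\log|2\sin u|\,du$ is the Lobachevsky function.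
   Formalization: Since ent vanishes on each edge of the square, strict concavity fails for two points of one edge; the formal statement asserts concavity on the whole closed square and strict inequality for distinct points whenever the intermediate point is interior to the square. *)

(* Defs.v *)
From mathcomp Require Import all_boot all_order all_algebra.
From mathcomp Require Import all_classical all_reals all_analysis.

Set Implicit Arguments.
Unset Strict Implicit.
Unset Printing Implicit Defensive.

Import Order.TTheory GRing.Theory Num.Theory.
Import numFieldNormedType.Exports.

Local Open Scope classical_set_scope.
Local Open Scope ring_scope.

(* [log |2 sin u|] is Lebesgue integrable on bounded intervals; its
   singularities at the multiples of [pi] form a null set, so the value
   [ln 0 = 0] there is irrelevant.  The second branch is the oriented
   integral from [0] to [z] for [z < 0]. *)
Definition lobachevsky (R : realType) (z : R) : R :=
  if 0 <= z
  then - \int[lebesgue_measure]_(u in `[0, z]) ln `|2 * sin u|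
  else \int[lebesgue_measure]_(u in `[z, 0]) ln `|2 * sin u|.

Definition p_a (R : realType) (s t : R) : R :=
  t / 4 + 1 / (2 * pi) * acos ((cos (pi * t / 2) - cos (pi * s / 2)) / 2).

Definition p_b (R : realType) (s t : R) : R :=
  - t / 4 + 1 / (2 * pi) * acos ((cos (pi * t / 2) - cos (pi * s / 2)) / 2).

Definition p_c (R : realType) (s t : R) : R :=
  - s / 4 + 1 / (2 * pi) * acos ((cos (pi * s / 2) - cos (pi * t / 2)) / 2).

Definition p_d (R : realType) (s t : R) : R :=
  s / 4 + 1 / (2 * pi) * acos ((cos (pi * s / 2) - cos (pi * t / 2)) / 2).

Definition ent (R : realType) (s t : R) : R :=
  1 / pi * (lobachevsky (pi * p_a s t) + lobachevsky (pi * p_b s t)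
          + lobachevsky (pi * p_c s t) + lobachevsky (pi * p_d s t)).

(* Strict concavity on a subset of the plane whose boundary may contain
   segments: the concavity inequality holds for all pairs of points of [A],
   boundary points included, and it is strict for distinct points as soon as
   the intermediate point is interior to [A].  Equality is allowed only when
   the intermediate point lies on the boundary (for convex [A]: when the whole
   segment does).  This cannot be dropped for [ent], which vanishes
   identically on each of the four edges of the square [|s| + |t| <= 2]. *)
Definition strictly_concave_on (R : realType) (A : set (R * R))
    (f : R -> R -> R) : Prop :=
  forall (s1 t1 s2 t2 k : R), A (s1, t1) -> A (s2, t2) -> 0 < k < 1 ->
    let s := k * s1 + (1 - k) * s2 in
    let t := k * t1 + (1 - k) * t2 in
    k * f s1 t1 + (1 - k) * f s2 t2 <= f s t
    /\ ((s1, t1) <> (s2, t2) -> interior A (s, t) ->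
        k * f s1 t1 + (1 - k) * f s2 t2 < f s t).

(* Main.v *)
(** Put [x = pi s / 2], [y = pi t / 2] and [al = acos ((cos y - cos x) / 2)].
    The angles [(al + y) / 2], [(al - y) / 2], [(pi - al - x) / 2] and
    [(pi - al + x) / 2] at which [ent] evaluates the Lobachevsky function [L] are
    nonnegative and sum to [pi], and depend linearly on [(x, y, al)].

    (1) [G (a, b, c, d) = L a + L b + L c + L d] is concave on the simplex
    [a + b + c + d = pi], strictly so in its interior.  Its second derivative in
    a direction of sum [0] is minus a form in cotangents, which is
    nonnegative because [cot a * v^2 + cot b * w^2 >= cot (a + b) * (v + w)^2],
    applied to [(a, b)] and to [(c, d)], where [cot (c + d) = - cot (a + b)].

    (2) For fixed [(x, y)], the given [al] is the unique maximiser of [G]: the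
    derivative of [G] in [al] has the sign of [cos al - (cos y - cos x) / 2].

    Thus [ent] is a partial maximum of a jointly concave function.  Over an
    interior point, either the averaged [al] is not the maximiser, and (2) is
    strict, or all four averaged angles are positive, and (1) is strict. *)

Require Import Defs.
From mathcomp Require Import all_boot all_order all_algebra.
From mathcomp Require Import all_classical all_reals all_analysis.
From mathcomp Require Import measurable_realfun lra ring.
Set Implicit Arguments.
Unset Strict Implicit.
Import Order.TTheory GRing.Theory Num.Theory.
Import numFieldNormedType.Exports.
Local Open Scope classical_set_scope.
Local Open Scope ring_scope.

(** * Mean values of first and second order *)

Lemma mean_value (R : realType) (f df : R -> R) (a b : R) :
  a < b -> (forall x : R, a < x < b -> is_derive x 1 f (df x)) ->
  {within `[a, b], continuous f} ->
  exists c, a < c < b /\ f b - f a = df c * (b - a).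
Proof.
move=> ab d cf.
have d' x : x \in `]a, b[ -> is_derive x 1 f (df x) by rewrite in_itv/=; exact: d.
by have [c cab e] := MVT ab d' cf; exists c; rewrite in_itv/= in cab.
Qed.

(** Mean values on either side of [k] are compared by a third one for [f1]. Derivatives are asked
    only in the open interval, since [L] has infinite slope at [0] and [pi]. *)
Lemma second_order_mean (R : realType) (f f1 f2 : R -> R) (k : R) :
  0 < k < 1 -> {within `[0, 1], continuous f} ->
  (forall x : R, 0 < x < 1 -> is_derive x 1 f (f1 x)) ->
  (forall x : R, 0 < x < 1 -> is_derive x 1 f1 (f2 x)) ->
  exists c m : R, [/\ 0 < c < 1, 0 < m &
    f k - ((1 - k) * f 0 + k * f 1) = - (m * f2 c)].
Proof.
move=> /andP[k0 k1] cf df1 df2.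
have sub01 (a b : R) : 0 <= a -> b <= 1 -> {within `[a, b], continuous f}.
  move=> a0 b1; apply: continuous_subspaceW cf => t.
  by rewrite /= !in_itv/= => /andP[? ?]; apply/andP; split; lra.
have d0k (x : R) : 0 < x < k -> is_derive x 1 f (f1 x) by move=> ?; apply: df1; lra.
have dk1 (x : R) : k < x < 1 -> is_derive x 1 f (f1 x) by move=> ?; apply: df1; lra.
have [x1 [x1P e1]] := mean_value k0 d0k (sub01 _ _ (lexx 0) (ltW k1)).
have [x2 [x2P e2]] := mean_value k1 dk1 (sub01 _ _ (ltW k0) (lexx 1)).
have x12 : x1 < x2 by lra.
have d12 (x : R) : x1 < x < x2 -> is_derive x 1 f1 (f2 x) by move=> ?; apply: df2; lra.
have cf1 : {within `[x1, x2], continuous f1}.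
  apply: derivable_within_continuous => x; rewrite in_itv/= => xP.
  by have [] : is_derive x 1 f1 (f2 x) by apply: df2; lra.
have [c [cP e3]] := mean_value x12 d12 cf1.
(* The defect equals [k * (1 - k) * (f1 x1 - f1 x2)], and [f1 x2 - f1 x1 = f2 c * (x2 - x1)]. *)
exists c, (k * (1 - k) * (x2 - x1)); split.
- by lra.
- by rewrite !mulr_gt0// subr_gt0.
- have -> : f k = f 0 + f1 x1 * k by lra.
  have -> : f 1 = f 0 + f1 x1 * k + f1 x2 * (1 - k) by lra.
  have -> : f1 x2 = f1 x1 + f2 c * (x2 - x1) by lra.
  ring.
Qed.

(** * The cotangent form *)

(** As cot (a + b) = (cot a cot b - 1) / (cot a + cot b), multiplying the left side by cot a + cot b
    leaves a sum of two squares; the last factor is 1 / (cot a + cot b). *)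
Lemma cot_add_defect (R : realType) (a b v w : R) :
  sin a != 0 -> sin b != 0 -> sin (a + b) != 0 ->
  v ^+ 2 * (cos a / sin a) + w ^+ 2 * (cos b / sin b)
    - (v + w) ^+ 2 * (cos (a + b) / sin (a + b)) =
  ((v * (cos a / sin a) - w * (cos b / sin b)) ^+ 2 + (v + w) ^+ 2)
    * (sin a * sin b / sin (a + b)).
Proof.
move=> sa sb; rewrite sinD cosD => sab; field.
by rewrite sab sa sb.
Qed.

Lemma cot_quad_add_lt (R : realType) (a b v w : R) :
  0 < a -> 0 < b -> a + b < pi -> (v, w) != (0, 0) ->
  (v + w) ^+ 2 * (cos (a + b) / sin (a + b)) <
  v ^+ 2 * (cos a / sin a) + w ^+ 2 * (cos b / sin b).
Proof.
move=> a0 b0 abpi vw0.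
have sa : 0 < sin a by apply: sin_gt0_pi; lra.
have sb : 0 < sin b by apply: sin_gt0_pi; lra.
have sab : 0 < sin (a + b) by apply: sin_gt0_pi; lra.
rewrite -subr_gt0 cot_add_defect ?gt_eqF//.
rewrite mulr_gt0 ?divr_gt0 ?mulr_gt0//.
rewrite lt_neqAle addr_ge0 ?sqr_ge0// andbT eq_sym paddr_eq0 ?sqr_ge0//.
rewrite !sqrf_eq0; apply/negP => /andP[/eqP h1 /eqP h2].
(* If both squares vanish, the base of the first becomes [v] times cot a + cot b, which is
   positive. *)
have wE : w = - v by lra.
move: h1; rewrite wE.
have -> : v * (cos a / sin a) - - v * (cos b / sin b) =
    v * (sin (a + b) / (sin a * sin b)).
  by rewrite sinD; field; rewrite !gt_eqF.
move/eqP; rewrite mulf_eq0 (gt_eqF (divr_gt0 sab (mulr_gt0 sa sb))) orbF => /eqP v0.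
by move: vw0; rewrite wE v0 oppr0 eqxx.
Qed.

(* The degenerate angles, where the quotients [cos / sin] take the junk value
   [0], occur on the boundary of the simplex. *)
Lemma cot_quad_add_le (R : realType) (a b v w : R) :
  0 <= a -> 0 <= b -> a + b <= pi -> v = 0 \/ 0 < a < pi -> w = 0 \/ 0 < b < pi ->
  (a + b = pi -> v + w = 0) ->
  (v + w) ^+ 2 * (cos (a + b) / sin (a + b)) <=
  v ^+ 2 * (cos a / sin a) + w ^+ 2 * (cos b / sin b).
Proof.
move=> a0 b0; rewrite le_eqVlt => /predU1P[abpi|abpi] hv hw hs.
  (* On this face cot b = - cot a and [w = - v], so both sides are [0]. *)
  have bE : b = pi - a by lra.
  have wE : w = - v by have := hs abpi; lra.
  rewrite bE wE (addrC pi) sinDpi cosDpi sinN cosN; lra.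
case: hv => [->|/andP[a1 _]].
  case: hw => [->|/andP[b1 _]]; first by rewrite !addr0 !expr0n/= !mul0r addr0.
  have [->|a_neq0] := eqVneq a 0; first by rewrite !add0r expr0n/= mul0r add0r.
  have [->|w0] := eqVneq w 0; first by rewrite !addr0 !expr0n/= !mul0r addr0.
  apply/ltW/cot_quad_add_lt => //; first by rewrite lt0r a_neq0.
  by apply/eqP => -[] /eqP; rewrite (negPf w0).
have [bE|b_neq0] := eqVneq b 0.
  case: hw => [->|]; last by rewrite bE ltxx.
  by rewrite bE !addr0 expr0n/= mul0r addr0.
have [/eqP[-> ->]|vw] := boolP ((v, w) == (0, 0)).
  by rewrite !addr0 !expr0n/= !mul0r addr0.
by apply/ltW/cot_quad_add_lt => //; rewrite lt0r b_neq0.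
Qed.

Lemma cot_piB (R : realType) (x : R) :
  cos (pi - x) / sin (pi - x) = - (cos x / sin x).
Proof. by rewrite (addrC pi) sinDpi cosDpi sinN cosN opprK mulNr. Qed.

Lemma cot_form_gt0 (R : realType) (a b c d u v w z : R) :
  a + b + c + d = pi -> u + v + w + z = 0 ->
  0 < a -> 0 < b -> 0 < c -> 0 < d ->
  (u, v, w, z) != (0, 0, 0, 0) ->
  0 < u ^+ 2 * (cos a / sin a) + v ^+ 2 * (cos b / sin b)
    + w ^+ 2 * (cos c / sin c) + z ^+ 2 * (cos d / sin d).
Proof.
move=> sum_pi sum0 a0 b0 c0 d0 n0.
have cdE : c + d = pi - (a + b) by lra.
have wzE : (w + z) ^+ 2 = (u + v) ^+ 2.
  by rewrite (_ : w + z = - (u + v)) ?sqrrN//; lra.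
(* A nonzero pair among (u, v) and (w, z) gives a strict bound, the other pair a weak one. *)
have [/eqP[u0 v0]|uv] := boolP ((u, v) == (0, 0)); last first.
  have := @cot_quad_add_lt R a b u v a0 b0 ltac:(lra) uv.
  have := @cot_quad_add_le R c d w z (ltW c0) (ltW d0) ltac:(lra) ltac:(lra) ltac:(lra) ltac:(lra).
  rewrite cdE cot_piB wzE; lra.
have wz : (w, z) != (0, 0).
  by apply/negP => /eqP[w0 z0]; move: n0; rewrite u0 v0 w0 z0 eqxx.
have := @cot_quad_add_lt R c d w z c0 d0 ltac:(lra) wz.
have := @cot_quad_add_le R a b u v (ltW a0) (ltW b0) ltac:(lra) ltac:(lra) ltac:(lra) ltac:(lra).
rewrite cdE cot_piB wzE; lra.
Qed.

(** The disjunctions describe a segment in the simplex at an interior parameter: an angle that moves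
    lies strictly between [0] and [pi], one that rests may be degenerate. *)
Lemma cot_form_ge0 (R : realType) (a b c d u v w z : R) :
  a + b + c + d = pi -> u + v + w + z = 0 ->
  0 <= a -> 0 <= b -> 0 <= c -> 0 <= d ->
  u = 0 \/ 0 < a < pi -> v = 0 \/ 0 < b < pi ->
  w = 0 \/ 0 < c < pi -> z = 0 \/ 0 < d < pi ->
  0 <= u ^+ 2 * (cos a / sin a) + v ^+ 2 * (cos b / sin b)
    + w ^+ 2 * (cos c / sin c) + z ^+ 2 * (cos d / sin d).
Proof.
move=> sum_pi sum0 a0 b0 c0 d0 ha hb hc hd.
have cdE : c + d = pi - (a + b) by lra.
have wzE : (w + z) ^+ 2 = (u + v) ^+ 2.
  by rewrite (_ : w + z = - (u + v)) ?sqrrN//; lra.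
have := @cot_quad_add_le R a b u v a0 b0 ltac:(lra) ha hb ltac:(lra).
have := @cot_quad_add_le R c d w z c0 d0 ltac:(lra) hc hd ltac:(lra).
rewrite cdE cot_piB wzE; lra.
Qed.

(** * Integrability of [ln |2 sin u|] *)

(** In sin w = 2 sin (w/2) cos (w/2), the mean value theorem makes sin (w/2) equal to w/2 times a
    cosine that is at least cos (w/2), and cos (w/2)^2 >= 1/2 because w/2 <= pi/4. *)
Lemma sin_ge_half (R : realType) (w : R) : 0 <= w <= pi / 2 -> w / 2 <= sin w.
Proof.
move=> /andP[w0 wpi].
have pi0 := @pi_gt0 R.
have half_sqr (x : R) : x \in `[0, pi / 4] -> 1 / 2 <= cos x ^+ 2.
  rewrite in_itv/= => /andP[x0 xpi].
  have := cos_mulr2n x.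
  have : 0 <= cos (x *+ 2) by apply: cos_ge0_pihalf; rewrite (mulr2n x); lra.
  lra.
have [->|w_neq0] := eqVneq w 0; first by rewrite sin0 mul0r.
have w_gt0 : 0 < w / 2 by rewrite divr_gt0// lt0r w_neq0.
have [c [cw e]] := mean_value w_gt0 (fun x _ => is_derive_sin x)
  (continuous_subspaceT (@continuous_sin R)).
rewrite sin0 !subr0 in e.
have coscw : cos (w / 2) <= cos c.
  by apply/ltW; rewrite ltr_cos ?in_itv/=; lra.
have cosw : 0 <= cos (w / 2) by apply: cos_ge0_pihalf; lra.
have h := half_sqr (w / 2) ltac:(by rewrite in_itv/=; lra).
have {2}-> : w = (w / 2) *+ 2 by rewrite (mulr2n (w / 2)); lra.
rewrite sin_mulr2n e (mulr2n (_ * _)).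
have h2 : cos (w / 2) ^+ 2 <= cos (w / 2) * cos c by rewrite expr2 ler_wpM2l.
have : (w / 2) * (cos (w / 2) ^+ 2) <= (w / 2) * (cos (w / 2) * cos c).
  by rewrite ler_wpM2l// ltW.
have : (w / 2) * (1 / 2) <= (w / 2) * (cos (w / 2) ^+ 2) by rewrite ler_wpM2l//; lra.
lra.
Qed.

(** From sin u = 2 sin (u/2) sin ((pi - u)/2), with the linear bound on each factor. *)
Lemma sin2_ge (R : realType) (u : R) : 0 <= u <= pi -> u * (pi - u) / 4 <= 2 * sin u.
Proof.
move=> /andP[u0 upi].
have h1 := @sin_ge_half R (u / 2) ltac:(lra).
have h2 := @sin_ge_half R ((pi - u) / 2) ltac:(lra).
have -> : sin u = 2 * (sin (u / 2) * sin ((pi - u) / 2)).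
  have {1}-> : u = (u / 2) *+ 2 by rewrite (mulr2n (u / 2)); lra.
  have -> : (pi - u) / 2 = - (u / 2) + pi / 2 by lra.
  by rewrite sinDpihalf cosN sin_mulr2n (mulr2n (_ * _)); lra.
have : (u / 2 / 2) * ((pi - u) / 2 / 2) <= sin (u / 2) * sin ((pi - u) / 2).
  by rewrite ler_pM//; lra.
lra.
Qed.

(** On closed subintervals the integral is a difference of values of [F], hence at most [2 * M];
    monotone convergence passes to the whole interval. *)
Lemma integrable_oo_of_primitive (R : realType) (f F : R -> R) (a b M : R) :
  a < b -> {in `]a, b[, forall x, 0 <= f x} -> {in `]a, b[, continuous f} ->
  (forall x : R, x \in `]a, b[ -> is_derive x 1 F (f x)) ->
  (forall x : R, x \in `]a, b[ -> `|F x| <= M) ->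
  lebesgue_measure.-integrable `]a, b[ (EFin \o f).
Proof.
move=> ab f0 cf dF FM.
have mf : measurable_fun `]a, b[ f.
  apply: open_continuous_measurable_fun; first exact: interval_open.
  by move=> x; rewrite inE => /cf.
apply/integrableP; split; first exact/measurable_EFinP.
(* Denominators starting at 3 keep [a + e n < b - e n] even for [n = 0]. *)
pose e (n : nat) : R := (b - a) / n.+3%:R.
have e_gt0 n : 0 < e n by rewrite divr_gt0 ?subr_gt0.
have e_le n : e n <= (b - a) / 3.
  by rewrite /e ler_pM2l ?subr_gt0// lef_pV2 ?posrE// ler_nat.
pose S n : set R := `[a + e n, b - e n]%classic.
have SE n x : x \in S n -> x \in `]a, b[.
  by rewrite inE /S/= !in_itv/= => /andP[? ?]; have := e_gt0 n; lra.
have US : `]a, b[%classic = \bigcup_n S n.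
  apply/seteqP; split => [x|x [n _ /mem_set /SE]]; last by [].
  rewrite /= in_itv/= => /andP[ax xb].
  pose r := Num.min (x - a) (b - x).
  have r0 : 0 < r by rewrite lt_min !subr_gt0 ax.
  (* The successor of this index exceeds [(b - a) / r], so [e n <= r]. *)
  exists (Num.trunc ((b - a) / r)) => //.
  set n := Num.trunc _.
  have er : e n <= r.
    rewrite /e ler_pdivrMr// mulrC -ler_pdivrMr//.
    apply: (le_trans (ltW (truncnS_gt _))).
    by rewrite ler_nat; exact: leqW.
  move: er; rewrite le_min => /andP[? ?].
  by rewrite /S/= in_itv/=; lra.
rewrite [X in (\int[_]_(x in X) _)%E]US.
suff h : (\int[lebesgue_measure]_(x in \bigcup_n S n) `|(EFin \o f) x| <= (2 * M)%:E)%E.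
  by apply: le_lt_trans h _; rewrite ltry.
have mS n : measurable (S n) by exact: measurable_itv.
have cvg : (\int[lebesgue_measure]_(x in S n) `|(EFin \o f) x|)%E @[n --> \oo] -->
    (\int[lebesgue_measure]_(x in \bigcup_n S n) `|(EFin \o f) x|)%E.
  apply: ge0_nondecreasing_set_cvg_integral => //.
  - move=> n m nm; apply/subsetPset => x; rewrite /S/= !in_itv/= => /andP[? ?].
    have : e m <= e n by rewrite /e ler_pM2l ?subr_gt0// lef_pV2 ?posrE// ler_nat !ltnS.
    lra.
  - move=> n; apply: measurableT_comp => //; apply/measurable_EFinP.
    by apply: measurable_funS mf => // x /mem_set /SE.
apply: cvge_le cvg.
apply: nearW => n.
have abn : a + e n < b - e n by have := e_le n; lra.
have intS : (\int[lebesgue_measure]_(x in S n) `|(EFin \o f) x| =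
    (F (b - e n))%:E - (F (a + e n))%:E)%E.
  transitivity (\int[lebesgue_measure]_(x in S n) (f x)%:E)%E.
    by apply: eq_integral => x /SE xab /=; rewrite ger0_norm ?f0.
  apply: continuous_FTC2 => //.
  - apply: continuous_in_subspaceT => x /SE; exact: cf.
  - have d x : x \in `[a + e n, b - e n] -> is_derive x 1 F (f x).
      by move=> xi; apply/dF/(SE n)/mem_set.
    split.
    + move=> x xi; have [] // : is_derive x 1 F (f x).
      by apply: d; exact: subset_itv_oo_cc.
    + apply: cvg_at_right_filter; apply: differentiable_continuous.
      apply/derivable1_diffP; have [] // : is_derive (a + e n) 1 F (f (a + e n)).
      by apply: d; rewrite in_itv/= lexx ltW.
    + apply: cvg_at_left_filter; apply: differentiable_continuous.
      apply/derivable1_diffP; have [] // : is_derive (b - e n) 1 F (f (b - e n)).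
      by apply: d; rewrite in_itv/= lexx ltW.
  - move=> x xi; rewrite derive1E.
    by have [] : is_derive x 1 F (f x) by apply/dF/(SE n)/mem_set; exact: subset_itv_oo_cc.
rewrite intS -EFinB lee_fin.
have := FM (a + e n) ltac:(rewrite in_itv/=; have := e_gt0 n; lra).
have := FM (b - e n) ltac:(rewrite in_itv/=; have := e_gt0 n; lra).
rewrite !ler_norml; lra.
Qed.
Lemma is_derive_xlnx (R : realType) (x : R) :
  0 < x -> is_derive x 1 (fun y : R => y * ln y - y) (ln x).
Proof.
move=> x0; have dln := is_derive1_ln x0.
have d := is_deriveB (is_deriveM (is_derive_id x 1) dln) (is_derive_id x 1).
apply: is_derive_eq d _.
by rewrite /GRing.scale/= mulfV ?gt_eqF// mulr1; ring.
Qed.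

(** The bound ln y < y at [x] and at [x^-1] gives -1 <= x ln x <= x^2. *)
Lemma norm_xlnx_le (R : realType) (x : R) :
  0 < x < pi -> `|x * ln x - x| <= pi ^+ 2 + 1 + pi.
Proof.
move=> /andP[x0 xpi].
have h1 : x * ln x <= x * x by rewrite ler_pM2l// ltW// ln_sublinear.
have h2 : x * - x^-1 <= x * ln x.
  rewrite ler_pM2l// lerNl -lnV ?posrE//.
  by rewrite ltW// ln_sublinear// invr_gt0.
rewrite mulrN mulfV ?gt_eqF// in h2.
have h3 : x * x <= pi * pi by rewrite ler_pM// ltW.
have := sqr_ge0 (pi : R).
rewrite ler_norml expr2; lra.
Qed.

Lemma integrable_ln_sin (R : realType) :
  (@lebesgue_measure R).-integrable `[0, pi] (EFin \o (fun u : R => ln `|2 * sin u|)).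
Proof.
have pi0 := @pi_gt0 R.
have ln2 : 0 < ln 2 :> R by apply: ln_gt0; lra.
have ln4 : 0 < ln 4 :> R by apply: ln_gt0; lra.
pose C : R := ln 4 + ln 2 + pi.
(* [sin2_ge] bounds [- ln (2 sin u)] by [ln 4 - ln u - ln (pi - u)], whose
   primitive is bounded; the larger constant makes [h] dominate [ln 2] too. *)
pose h (u : R) := C - ln u - ln (pi - u).
pose K (x : R) := x * ln x - x.
have lns (u : R) : 0 < u < pi -> [/\ 0 < 2 * sin u, ln (2 * sin u) <= ln 2 &
    ln u + ln (pi - u) - ln 4 <= ln (2 * sin u)].
  move=> /andP[u0 upi].
  have p1 : 0 < u * (pi - u) by rewrite mulr_gt0// subr_gt0.
  have ge := @sin2_ge R u ltac:(lra).
  have p2 : 0 < u * (pi - u) / 4 by lra.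
  split; first lra.
  - rewrite ler_ln ?posrE//; first (by have := sin_le1 u; lra); lra.
  - rewrite -lnM ?posrE ?subr_gt0// -ln_div ?posrE// ler_ln ?posrE//; lra.
(* The summand [pi] of [C] is u + (pi - u), which exceeds ln u + ln (pi - u); hence [h] exceeds
   [ln 4 + ln 2]. *)
have hb (u : R) : 0 < u < pi -> 0 <= h u /\ `|ln `|2 * sin u| | <= h u.
  move=> uP; have [s0 s1 s2] := lns u uP.
  rewrite (gtr0_norm s0) ler_norml.
  have := @ln_sublinear R u ltac:(lra).
  have := @ln_sublinear R (pi - u) ltac:(lra).
  by rewrite /h /C; lra.
have mf : measurable_fun [set: R] (fun u : R => ln `|2 * sin u|).
  apply: measurableT_comp; first exact: measurable_ln.
  apply: measurableT_comp => //; apply: continuous_measurable_fun => x.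
  by apply: cvgM; [exact: cvg_cst|exact: continuous_sin].
have h0 : {in `]0, pi[, forall u, 0 <= h u} by move=> u; rewrite in_itv/= => /hb[].
have ch : {in `]0, pi[, continuous h}.
  move=> u; rewrite in_itv/= => uP.
  apply: cvgB; first (apply: cvgB; [exact: cvg_cst|apply: continuous_ln; lra]).
  apply: (@continuous_comp _ _ _ (fun u : R => pi - u) (@ln R)).
    by apply: cvgB; [exact: cvg_cst|exact: cvg_id].
  by apply: continuous_ln; lra.
pose H (u : R) := C * u - K u + K (pi - u).
have dH (u : R) : u \in `]0, pi[ -> is_derive u 1 H (h u).
  rewrite in_itv/= => uP.
  have d1 := @is_derive_xlnx R u ltac:(lra).
  have d2 := @is_derive_xlnx R (pi - u) ltac:(lra).
  have d3 : is_derive u 1 (fun y : R => pi - y) (0 - 1).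
    exact: is_deriveB (is_derive_cst pi u 1) (is_derive_id u 1).
  have d4 : is_derive u 1 (fun y : R => K (pi - y)) (ln (pi - u) * (0 - 1)).
    exact: (@is_derive1_comp R K (fun y : R => pi - y) u _ _ d2 d3).
  have d5 := is_deriveD (is_deriveB (is_deriveZ C (is_derive_id u 1)) d1) d4.
  apply: is_derive_eq d5 _.
  by rewrite /GRing.scale/= /h; ring.
have Hb (u : R) : u \in `]0, pi[ -> `|H u| <= C * pi + 2 * (pi ^+ 2 + 1 + pi).
  rewrite in_itv/= => uP.
  have := @norm_xlnx_le R u uP.
  have := @norm_xlnx_le R (pi - u) ltac:(lra).
  have : 0 <= C by rewrite /C; lra.
  have : C * u <= C * pi by rewrite ler_wpM2l// /C; lra.
  have : 0 <= C * u by rewrite mulr_ge0// /C; lra.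
  by rewrite /H /K !ler_norml; lra.
have inth := integrable_oo_of_primitive pi0 h0 ch dH Hb.
have intoo : (@lebesgue_measure R).-integrable `]0, pi[
    (EFin \o (fun u : R => ln `|2 * sin u|)).
  apply: le_integrable inth => //.
  - by apply/measurable_EFinP; exact: measurable_funTS.
  - move=> u /=; rewrite in_itv/= => /hb[hu0 hu].
    by rewrite lee_fin (ger0_norm hu0).
apply/integrableP; split; first by apply/measurable_EFinP; exact: measurable_funTS.
(* The two endpoints form a null set. *)
rewrite integral_itv_bndoo; first by case/integrableP: intoo.
apply: measurableT_comp => //.
by apply/measurable_EFinP; exact: measurable_funTS.
Qed.

(** * The Lobachevsky function *)

(** The integral of an integrable function is continuous in its upper bound, here up to the
    endpoints, where the derivative blows up. *)
Lemma continuous_lobachevsky (R : realType) :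
  {within `[0, pi], continuous (@lobachevsky R)}.
Proof.
have cont := parameterized_integral_continuous (pi_ge0 R) (@integrable_ln_sin R).
apply: (@subspace_eq_continuous _ _ _ (fun z => - parameterized_integral
    lebesgue_measure 0 z (fun u : R => ln `|2 * sin u|))).
  by move=> z; rewrite inE/= in_itv/= => /andP[z0 _]; rewrite /from_subspace /lobachevsky ifT.
by move=> z; apply: cvgN; exact: cont.
Qed.

Lemma is_derive_lobachevsky (R : realType) (z : R) :
  0 < z < pi -> is_derive z 1 (@lobachevsky R) (- ln (2 * sin z)).
Proof.
move=> zP; have [z0 zpi] := andP zP.
have s0 : 0 < 2 * sin z by rewrite mulr_gt0// sin_gt0_pi.
have cf : {for z, continuous (fun u : R => ln `|2 * sin u|)}.
  apply: (@continuous_comp _ _ _ (fun u : R => `|2 * sin u|) (@ln R)).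
    by apply: cvg_norm; apply: cvgM; [exact: cvg_cst|exact: continuous_sin].
  by apply: continuous_ln; rewrite gtr0_norm.
have [dF eF] := continuous_FTC1_closed zpi (@integrable_ln_sin R) z0 cf.
rewrite derive1E (gtr0_norm s0) in eF.
have := is_deriveN (DeriveDef dF eF).
apply: near_eq_is_derive.
(* The first branch of [lobachevsky] applies in a whole neighbourhood of [z]. *)
have /near_in_itvoo zI : z \in `]0, pi[ by rewrite in_itv.
apply: filterS zI => x; rewrite in_itv/= => /andP[x0 _].
by rewrite /lobachevsky (ltW x0).
Qed.

Lemma within_continuous_comp_subset (T U V : topologicalType) (A : set T)
    (B : set U) (f : T -> U) (g : U -> V) :
  (forall x, A x -> B (f x)) -> {within A, continuous f} ->
  {within B, continuous g} -> {within A, continuous (g \o f)}.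
Proof.
move=> fAB /subspace_continuousP cf /subspace_continuousP cg.
apply/subspace_continuousP => x Ax.
have := cg (f x) (fAB x Ax); apply: cvg_comp => P; rewrite /= /within => nP.
have h : \forall y \near x, A y -> B (f y) -> P (f y) := cf x Ax _ nP.
suff : \forall y \near x, A y -> P (f y) by [].
by apply: filterS h => y hy Ay; exact: hy Ay (fAB _ Ay).
Qed.

(** * [L] along an affine path of angles *)

Section lobachevsky_segment.
Variables (R : realType) (p q : R).
Hypotheses (p0pi : 0 <= p <= pi) (q0pi : 0 <= q <= pi).
(** Oriented so that [x] is the weight of [p], as [k] is that of the first point in strict
    concavity. *)
Let theta (x : R) := q + x * (p - q).

Lemma segment_itvcc x : 0 <= x <= 1 -> 0 <= theta x <= pi.
Proof.
move=> /andP[x0 x1].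
have [p0 p1] := andP p0pi; have [q0 q1] := andP q0pi.
have -> : theta x = x * p + (1 - x) * q by rewrite /theta; ring.
have : 0 <= x * p by rewrite mulr_ge0.
have : 0 <= (1 - x) * q by rewrite mulr_ge0// subr_ge0.
have : x * p <= x * pi by rewrite ler_wpM2l.
have : (1 - x) * q <= (1 - x) * pi by rewrite ler_wpM2l// subr_ge0.
lra.
Qed.

(** A proper average of two distinct angles avoids the extreme values; a constant path may rest at
    [0] or [pi], hence the first alternative. *)
Lemma segment_itvoo x : 0 < x < 1 -> p - q = 0 \/ 0 < theta x < pi.
Proof.
move=> /andP[x0 x1].
have [p0 p1] := andP p0pi; have [q0 q1] := andP q0pi.
have [->|pq] := eqVneq p q; first by left; rewrite subrr.
right.
have -> : theta x = x * p + (1 - x) * q by rewrite /theta; ring.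
have y0 : 0 < 1 - x by rewrite subr_gt0.
have [plq|plq] := ltrP p q.
  have : 0 <= x * p by rewrite mulr_ge0// ltW.
  have : x * p <= x * pi by rewrite ler_pM2l.
  have : 0 < (1 - x) * q by rewrite mulr_gt0//; lra.
  have : x * p < x * q by rewrite ltr_pM2l.
  have : (1 - x) * q <= (1 - x) * pi by rewrite ler_pM2l.
  have : x * q <= x * pi by rewrite ler_pM2l.
  lra.
have qp : q < p by rewrite lt_neqAle eq_sym pq.
have : 0 < x * p by rewrite mulr_gt0//; lra.
have : 0 <= (1 - x) * q by rewrite mulr_ge0// ltW.
have : x * p <= x * pi by rewrite ler_pM2l.
have : (1 - x) * q < (1 - x) * p by rewrite ltr_pM2l.
have : (1 - x) * p <= (1 - x) * pi by rewrite ler_pM2l.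
lra.
Qed.

Lemma is_derive_segment (x : R) : is_derive x 1 theta (p - q).
Proof.
have d := is_deriveD (is_derive_cst q x 1)
  (is_deriveM (is_derive_id x 1) (is_derive_cst (p - q) x 1)).
by apply: is_derive_eq d _; rewrite /GRing.scale/=; ring.
Qed.

Lemma continuous_lobachevsky_segment :
  {within `[0, 1], continuous (@lobachevsky R \o theta)}.
Proof.
apply: within_continuous_comp_subset (@continuous_lobachevsky R).
  by move=> x; rewrite /= !in_itv/=; exact: segment_itvcc.
apply: derivable_within_continuous => x _.
by have [] := is_derive_segment x.
Qed.

(** On a constant path the factor [p - q] cancels the logarithm whatever its value, so an angle
    resting at [0] or [pi] is covered. *)
Lemma is_derive_lobachevsky_segment (x : R) : 0 < x < 1 ->
  is_derive x 1 (@lobachevsky R \o theta) (- ((p - q) * ln (2 * sin (theta x)))).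
Proof.
move=> /segment_itvoo[pq|tx].
  have -> : @lobachevsky R \o theta = cst (lobachevsky q).
    by apply/funext => y; rewrite /theta/= pq mulr0 addr0.
  by apply: is_derive_eq (is_derive_cst _ _ _) _; rewrite pq mul0r oppr0.
apply: is_derive_eq (is_derive1_comp (is_derive_lobachevsky tx) (is_derive_segment x)) _.
by rewrite mulNr mulrC.
Qed.

Lemma is_derive2_lobachevsky_segment (x : R) : 0 < x < 1 ->
  is_derive x 1 (fun x : R => - ((p - q) * ln (2 * sin (theta x))))
    (- ((p - q) ^+ 2 * (cos (theta x) / sin (theta x)))).
Proof.
move=> /segment_itvoo[pq|tx].
  have -> : (fun x : R => - ((p - q) * ln (2 * sin (theta x)))) = cst 0.
    by apply/funext => y; rewrite pq mul0r oppr0.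
  by apply: is_derive_eq (is_derive_cst _ _ _) _; rewrite pq expr0n/= mul0r oppr0.
have s0 : 0 < sin (theta x) by exact: sin_gt0_pi.
have s20 : 0 < 2 * sin (theta x) by rewrite mulr_gt0.
have d1 := is_derive1_comp (is_derive_sin (theta x)) (is_derive_segment x).
pose g (y : R) := 2 * sin (theta y).
have d2 : is_derive x 1 g (2 * (cos (theta x) * (p - q))) := is_deriveZ 2 d1.
have d3 := @is_derive1_comp R (@ln R) g x _ _ (is_derive1_ln s20) d2.
have d4 := is_deriveN (is_deriveZ (p - q) d3).
apply: is_derive_eq d4 _.
by rewrite /GRing.scale/=; field; rewrite gt_eqF.
Qed.

End lobachevsky_segment.

(** * Concavity on the simplex of angles *)

Definition lob4 (R : realType) (a b c d : R) : R :=
  lobachevsky a + lobachevsky b + lobachevsky c + lobachevsky d.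

Lemma continuous_lob4_segment (R : realType) (a1 b1 c1 d1 a2 b2 c2 d2 : R) :
  0 <= a1 -> 0 <= b1 -> 0 <= c1 -> 0 <= d1 -> a1 + b1 + c1 + d1 = pi ->
  0 <= a2 -> 0 <= b2 -> 0 <= c2 -> 0 <= d2 -> a2 + b2 + c2 + d2 = pi ->
  {within `[0, 1], continuous (fun x : R => lob4 (a2 + x * (a1 - a2))
    (b2 + x * (b1 - b2)) (c2 + x * (c1 - c2)) (d2 + x * (d1 - d2)))}.
Proof.
move=> a10 b10 c10 d10 s1 a20 b20 c20 d20 s2.
have ca := @continuous_lobachevsky_segment R a1 a2 ltac:(lra) ltac:(lra).
have cb := @continuous_lobachevsky_segment R b1 b2 ltac:(lra) ltac:(lra).
have cc := @continuous_lobachevsky_segment R c1 c2 ltac:(lra) ltac:(lra).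
have cd := @continuous_lobachevsky_segment R d1 d2 ltac:(lra) ltac:(lra).
move=> x; apply: cvgD; last exact: cd.
by apply: cvgD; last exact: cc; apply: cvgD; [exact: ca|exact: cb].
Qed.

Lemma is_derive_lob4_segment (R : realType) (a1 b1 c1 d1 a2 b2 c2 d2 x : R) :
  0 <= a1 -> 0 <= b1 -> 0 <= c1 -> 0 <= d1 -> a1 + b1 + c1 + d1 = pi ->
  0 <= a2 -> 0 <= b2 -> 0 <= c2 -> 0 <= d2 -> a2 + b2 + c2 + d2 = pi ->
  0 < x < 1 ->
  is_derive x 1 (fun x : R => lob4 (a2 + x * (a1 - a2))
      (b2 + x * (b1 - b2)) (c2 + x * (c1 - c2)) (d2 + x * (d1 - d2)))
    (- ((a1 - a2) * ln (2 * sin (a2 + x * (a1 - a2))))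
     - (b1 - b2) * ln (2 * sin (b2 + x * (b1 - b2)))
     - (c1 - c2) * ln (2 * sin (c2 + x * (c1 - c2)))
     - (d1 - d2) * ln (2 * sin (d2 + x * (d1 - d2)))).
Proof.
move=> a10 b10 c10 d10 s1 a20 b20 c20 d20 s2 x01.
have da := @is_derive_lobachevsky_segment R a1 a2 ltac:(lra) ltac:(lra) x x01.
have db := @is_derive_lobachevsky_segment R b1 b2 ltac:(lra) ltac:(lra) x x01.
have dc := @is_derive_lobachevsky_segment R c1 c2 ltac:(lra) ltac:(lra) x x01.
have dd := @is_derive_lobachevsky_segment R d1 d2 ltac:(lra) ltac:(lra) x x01.
exact: is_deriveD (is_deriveD (is_deriveD da db) dc) dd.
Qed.

Lemma is_derive2_lob4_segment (R : realType) (a1 b1 c1 d1 a2 b2 c2 d2 x : R) :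
  0 <= a1 -> 0 <= b1 -> 0 <= c1 -> 0 <= d1 -> a1 + b1 + c1 + d1 = pi ->
  0 <= a2 -> 0 <= b2 -> 0 <= c2 -> 0 <= d2 -> a2 + b2 + c2 + d2 = pi ->
  0 < x < 1 ->
  is_derive x 1 (fun x : R =>
      - ((a1 - a2) * ln (2 * sin (a2 + x * (a1 - a2))))
      - (b1 - b2) * ln (2 * sin (b2 + x * (b1 - b2)))
      - (c1 - c2) * ln (2 * sin (c2 + x * (c1 - c2)))
      - (d1 - d2) * ln (2 * sin (d2 + x * (d1 - d2))))
    (- ((a1 - a2) ^+ 2 * (cos (a2 + x * (a1 - a2)) / sin (a2 + x * (a1 - a2))))
     - (b1 - b2) ^+ 2 * (cos (b2 + x * (b1 - b2)) / sin (b2 + x * (b1 - b2)))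
     - (c1 - c2) ^+ 2 * (cos (c2 + x * (c1 - c2)) / sin (c2 + x * (c1 - c2)))
     - (d1 - d2) ^+ 2 * (cos (d2 + x * (d1 - d2)) / sin (d2 + x * (d1 - d2)))).
Proof.
move=> a10 b10 c10 d10 s1 a20 b20 c20 d20 s2 x01.
have da := @is_derive2_lobachevsky_segment R a1 a2 ltac:(lra) ltac:(lra) x x01.
have db := @is_derive2_lobachevsky_segment R b1 b2 ltac:(lra) ltac:(lra) x x01.
have dc := @is_derive2_lobachevsky_segment R c1 c2 ltac:(lra) ltac:(lra) x x01.
have dd := @is_derive2_lobachevsky_segment R d1 d2 ltac:(lra) ltac:(lra) x x01.
exact: is_deriveD (is_deriveD (is_deriveD da db) dc) dd.
Qed.

(** Positivity is known at [k] but wanted at an uncontrolled mean value point [x]: it makes [p] or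
    [q] positive, hence every proper average. *)
Lemma segment_gt0 (R : realType) (p q k x : R) : 0 <= p -> 0 <= q ->
  0 < k < 1 -> 0 < q + k * (p - q) -> 0 < x < 1 -> 0 < q + x * (p - q).
Proof.
move=> p0 q0 /andP[k0 k1] m0 /andP[x0 x1].
have -> : q + x * (p - q) = x * p + (1 - x) * q by ring.
have [pE|pn0] := eqVneq p 0.
  have [qE|qn0] := eqVneq q 0; first by move: m0; rewrite pE qE; lra.
  by rewrite pE mulr0 add0r mulr_gt0 ?subr_gt0// lt0r qn0.
have : 0 < x * p by rewrite mulr_gt0// lt0r pn0.
have : 0 <= (1 - x) * q by rewrite mulr_ge0// subr_ge0 ltW.
lra.
Qed.

(** The second-order mean value turns the concavity gap into a positive multiple of the cotangent
    form at one interior parameter, in the direction of the angle differences. *)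
Lemma lob4_concave (R : realType) (a1 b1 c1 d1 a2 b2 c2 d2 k : R) :
  0 <= a1 -> 0 <= b1 -> 0 <= c1 -> 0 <= d1 -> a1 + b1 + c1 + d1 = pi ->
  0 <= a2 -> 0 <= b2 -> 0 <= c2 -> 0 <= d2 -> a2 + b2 + c2 + d2 = pi ->
  0 < k < 1 ->
  let a := a2 + k * (a1 - a2) in let b := b2 + k * (b1 - b2) in
  let c := c2 + k * (c1 - c2) in let d := d2 + k * (d1 - d2) in
  k * lob4 a1 b1 c1 d1 + (1 - k) * lob4 a2 b2 c2 d2 <= lob4 a b c d /\
  ((a1 - a2, b1 - b2, c1 - c2, d1 - d2) != (0, 0, 0, 0) ->
   0 < a -> 0 < b -> 0 < c -> 0 < d ->
   k * lob4 a1 b1 c1 d1 + (1 - k) * lob4 a2 b2 c2 d2 < lob4 a b c d).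
Proof.
move=> a10 b10 c10 d10 s1 a20 b20 c20 d20 s2 k01 /=.
have [a1pi b1pi c1pi d1pi] :
  [/\ 0 <= a1 <= pi, 0 <= b1 <= pi, 0 <= c1 <= pi & 0 <= d1 <= pi] by split; lra.
have [a2pi b2pi c2pi d2pi] :
  [/\ 0 <= a2 <= pi, 0 <= b2 <= pi, 0 <= c2 <= pi & 0 <= d2 <= pi] by split; lra.
have cf := continuous_lob4_segment a10 b10 c10 d10 s1 a20 b20 c20 d20 s2.
have df (x : R) (x01 : 0 < x < 1) :=
  is_derive_lob4_segment a10 b10 c10 d10 s1 a20 b20 c20 d20 s2 x01.
have d2f (x : R) (x01 : 0 < x < 1) :=
  is_derive2_lob4_segment a10 b10 c10 d10 s1 a20 b20 c20 d20 s2 x01.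
have [x [m [x01 m0]]] := second_order_mean k01 cf df d2f.
have seg0 (p q : R) : q + 0 * (p - q) = q by ring.
have seg1 (p q : R) : q + 1 * (p - q) = p by ring.
rewrite !seg0 !seg1 => e.
have sum_pi : a2 + x * (a1 - a2) + (b2 + x * (b1 - b2)) + (c2 + x * (c1 - c2))
    + (d2 + x * (d1 - d2)) = pi.
  have -> : a2 + x * (a1 - a2) + (b2 + x * (b1 - b2)) + (c2 + x * (c1 - c2))
    + (d2 + x * (d1 - d2)) = (1 - x) * (a2 + b2 + c2 + d2)
    + x * (a1 + b1 + c1 + d1) by ring.
  by rewrite s1 s2; ring.
have sum0 : a1 - a2 + (b1 - b2) + (c1 - c2) + (d1 - d2) = 0 by lra.
have x01' : 0 <= x <= 1 by have [x0 x1] := andP x01; rewrite !ltW.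
split.
- have ha := segment_itvcc a1pi a2pi x01'.
  have hb := segment_itvcc b1pi b2pi x01'.
  have hc := segment_itvcc c1pi c2pi x01'.
  have hd := segment_itvcc d1pi d2pi x01'.
  have q := cot_form_ge0 sum_pi sum0 (proj1 (andP ha)) (proj1 (andP hb))
    (proj1 (andP hc)) (proj1 (andP hd))
    (segment_itvoo a1pi a2pi x01)
    (segment_itvoo b1pi b2pi x01)
    (segment_itvoo c1pi c2pi x01)
    (segment_itvoo d1pi d2pi x01).
  move: e (mulr_ge0 (ltW m0) q); clear; lra.
- move=> n0 a0 b0 c0 d0.
  have q := cot_form_gt0 sum_pi sum0
    (segment_gt0 a10 a20 k01 a0 x01) (segment_gt0 b10 b20 k01 b0 x01)
    (segment_gt0 c10 c20 k01 c0 x01) (segment_gt0 d10 d20 k01 d0 x01) n0.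
  move: e (mulr_gt0 m0 q); clear; lra.
Qed.

(** * Maximality in [al] *)

(** Merges the logarithms of two paired angles of [lob_alpha], whose difference depends only on [x]
    or [y] and whose sum only on [al]. *)
Lemma sin_mul_sin (R : realType) (u v : R) :
  2 * sin u * (2 * sin v) = 2 * (cos (u - v) - cos (u + v)).
Proof. by rewrite cosB cosD; ring. Qed.

(** The four arguments are pi times [p_a], [p_b], [p_c], [p_d] when [al] is the arccosine; a free
    [al] can be averaged along with [x] and [y]. *)
Definition lob_alpha (R : realType) (x y al : R) : R :=
  lob4 ((al + y) / 2) ((al - y) / 2) ((pi - al - x) / 2) ((pi - al + x) / 2).

(** One mean value between [al] and [be] suffices: at the intermediate [A] the derivative in the
    angle has the sign of cos A - cos be, and cosine decreases on [0, pi]. *)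
Lemma lob_alpha_lt (R : realType) (x y al be : R) :
  0 <= al + y -> 0 <= al - y -> 0 <= pi - al - x -> 0 <= pi - al + x ->
  0 <= be + y -> 0 <= be - y -> 0 <= pi - be - x -> 0 <= pi - be + x ->
  cos be = (cos y - cos x) / 2 -> al != be ->
  lob_alpha x y al < lob_alpha x y be.
Proof.
move=> al1 al2 al3 al4 be1 be2 be3 be4 cosbe albe.
have [al0pi be0pi] : 0 <= al <= pi /\ 0 <= be <= pi by split; lra.
pose a1 := (be + y) / 2; pose b1 := (be - y) / 2.
pose c1 := (pi - be - x) / 2; pose d1 := (pi - be + x) / 2.
pose a2 := (al + y) / 2; pose b2 := (al - y) / 2.
pose c2 := (pi - al - x) / 2; pose d2 := (pi - al + x) / 2.
have [a10 b10 c10 d10] : [/\ 0 <= a1, 0 <= b1, 0 <= c1 & 0 <= d1].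
  by rewrite /a1 /b1 /c1 /d1; split; lra.
have [a20 b20 c20 d20] : [/\ 0 <= a2, 0 <= b2, 0 <= c2 & 0 <= d2].
  by rewrite /a2 /b2 /c2 /d2; split; lra.
have s1 : a1 + b1 + c1 + d1 = pi by rewrite /a1 /b1 /c1 /d1; lra.
have s2 : a2 + b2 + c2 + d2 = pi by rewrite /a2 /b2 /c2 /d2; lra.
have cf := continuous_lob4_segment a10 b10 c10 d10 s1 a20 b20 c20 d20 s2.
have df (t : R) (t01 : 0 < t < 1) :=
  is_derive_lob4_segment a10 b10 c10 d10 s1 a20 b20 c20 d20 s2 t01.
have [t [t01]] := mean_value ltr01 df cf.
have seg0 (p q : R) : q + 0 * (p - q) = q by ring.
have seg1 (p q : R) : q + 1 * (p - q) = p by ring.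
rewrite !seg0 !seg1 subr0 mulr1 -!/(lob_alpha _ _ _) => e.
rewrite -subr_gt0 [X in 0 < X]e {cf df e}.
pose de := be - al; have de0 : de != 0 by rewrite subr_eq0 eq_sym.
have [dea deb dec ded] : [/\ a1 - a2 = de / 2, b1 - b2 = de / 2,
    c1 - c2 = - de / 2 & d1 - d2 = - de / 2].
  by rewrite /a1 /b1 /c1 /d1 /a2 /b2 /c2 /d2 /de; split; field.
(* As [de] is nonzero all four angles move, so inside the segment they avoid [0] and [pi]. *)
have pos (p q : R) : 0 <= p -> 0 <= q -> p <= pi -> q <= pi -> p - q != 0 ->
    0 < 2 * sin (q + t * (p - q)).
  move=> p0 q0 ppi qpi pq.
  have p0pi : 0 <= p <= pi by rewrite p0.
  have q0pi : 0 <= q <= pi by rewrite q0.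
  have [pq0|h] := segment_itvoo p0pi q0pi t01; first by rewrite pq0 eqxx in pq.
  by rewrite mulr_gt0// sin_gt0_pi.
have le_pi (p q r s : R) : 0 <= p -> 0 <= q -> 0 <= r -> 0 <= s ->
    p + q + r + s = pi -> [/\ p <= pi, q <= pi, r <= pi & s <= pi].
  by clear; move=> *; split; lra.
have [a1pi b1pi c1pi d1pi] := le_pi _ _ _ _ a10 b10 c10 d10 s1.
have [a2pi b2pi c2pi d2pi] := le_pi _ _ _ _ a20 b20 c20 d20 s2.
have h0 : de / 2 != 0 by rewrite mulf_neq0// invr_eq0.
have Nh0 : - de / 2 != 0 by rewrite mulNr oppr_eq0.
have sa := pos a1 a2 a10 a20 a1pi a2pi ltac:(by rewrite dea).
have sb := pos b1 b2 b10 b20 b1pi b2pi ltac:(by rewrite deb).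
have sc := pos c1 c2 c10 c20 c1pi c2pi ltac:(by rewrite dec).
have sd := pos d1 d2 d10 d20 d1pi d2pi ltac:(by rewrite ded).
rewrite dea deb dec ded in sa sb sc sd *.
set A := al + t * de.
have abB : a2 + t * (de / 2) - (b2 + t * (de / 2)) = y by rewrite /a2 /b2; field.
have abD : a2 + t * (de / 2) + (b2 + t * (de / 2)) = A by rewrite /a2 /b2 /A; field.
have cdB : c2 + t * (- de / 2) - (d2 + t * (- de / 2)) = - x.
  by rewrite /c2 /d2; field.
have cdD : c2 + t * (- de / 2) + (d2 + t * (- de / 2)) = - A + pi.
  by rewrite /c2 /d2 /A; field.
have pab : 0 < 2 * (cos y - cos A).
  by have := mulr_gt0 sa sb; rewrite sin_mul_sin abB abD.
have pcd : 0 < 2 * (cos x + cos A).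
  by have := mulr_gt0 sc sd; rewrite sin_mul_sin cdB cdD cosN cosDpi cosN opprK.
have lnab : ln (2 * sin (a2 + t * (de / 2))) + ln (2 * sin (b2 + t * (de / 2))) =
    ln (2 * (cos y - cos A)).
  by rewrite -lnM ?posrE// sin_mul_sin abB abD.
have lncd : ln (2 * sin (c2 + t * (- de / 2))) + ln (2 * sin (d2 + t * (- de / 2))) =
    ln (2 * (cos x + cos A)).
  by rewrite -lnM ?posrE// sin_mul_sin cdB cdD cosN cosDpi cosN opprK.
have -> : - (de / 2 * ln (2 * sin (a2 + t * (de / 2))))
    - de / 2 * ln (2 * sin (b2 + t * (de / 2)))
    - - de / 2 * ln (2 * sin (c2 + t * (- de / 2)))
    - - de / 2 * ln (2 * sin (d2 + t * (- de / 2))) =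
    de / 2 * (ln (2 * (cos x + cos A)) - ln (2 * (cos y - cos A))).
  by rewrite -lnab -lncd; ring.
have [t0 t1] := andP t01.
have A0pi : A \in `[0, pi].
  by rewrite in_itv; apply: segment_itvcc be0pi al0pi _ _; rewrite !ltW.
have be_itv : be \in `[0, pi] by rewrite in_itv.
have beA : be - A = (1 - t) * de by rewrite /A /de; ring.
(* The logarithms compare as cos x + cos A with cos y - cos A, that is, as cos A with cos be. *)
have [debe|debe] := ltrP 0 de.
  have Abe : A < be by rewrite -subr_gt0 beA mulr_gt0// subr_gt0.
  have cosA : cos be < cos A by rewrite ltr_cos.
  rewrite mulr_gt0 ?divr_gt0// subr_gt0 ltr_ln ?posrE//.
  by move: cosA cosbe; clear; lra.
have de_lt0 : de < 0 by rewrite lt_neqAle de0.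
have Abe : be < A by rewrite -subr_lt0 beA pmulr_rlt0// subr_gt0.
have cosA : cos A < cos be by rewrite ltr_cos.
rewrite nmulr_rgt0 ?subr_lt0 ?ltr_ln ?posrE//.
  by move: cosA cosbe; clear; lra.
by move: de_lt0; clear; lra.
Qed.

(** * From the square to the angles *)

(** Since |x| + |y| <= pi, cos x + cos y >= 0; so cos al lies between - cos x = cos (pi - |x|) and
    cos y, and cosine decreases on [0, pi]. *)
Lemma acos_half_bounds (R : realType) (x y : R) : `|x| + `|y| <= pi ->
  let al := acos ((cos y - cos x) / 2) in
  [/\ cos al = (cos y - cos x) / 2, acos ((cos x - cos y) / 2) = pi - al,
      `|y| <= al, al <= pi - `|x| & `|x| + `|y| < pi -> `|y| < al < pi - `|x|].
Proof.
move=> xy /=; set w := (cos y - cos x) / 2.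
have w1 : -1 <= w <= 1.
  have := cos_le1 x; have := cos_le1 y; have := cos_geN1 x; have := cos_geN1 y.
  by rewrite /w; clear; lra.
have x0 := normr_ge0 x; have y0 := normr_ge0 y.
have cosal : cos (acos w) = w by rewrite acosK// in_itv.
have al0 := acos_ge0 w1; have alpi := acos_lepi w1.
have alI : acos w \in `[0, pi] by rewrite in_itv/= al0.
have yI : `|y| \in `[0, pi] by rewrite in_itv/=; lra.
have xI : `|x| \in `[0, pi] by rewrite in_itv/=; lra.
have pyI : pi - `|y| \in `[0, pi] by rewrite in_itv/=; lra.
have pxI : pi - `|x| \in `[0, pi] by rewrite in_itv/=; lra.
have cosB (z : R) : cos (pi - `|z|) = - cos z.
  by rewrite addrC cosDpi cosN cos_norm.
have ler_cos : {in `[0, pi] &, {mono @cos R : u v /~ v <= u}}.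
  by move=> u v uI vI; rewrite !leNgt ltr_cos.
have cosxy : - cos y <= cos x by rewrite -cosB -(cos_norm x) ler_cos//; lra.
split.
- exact: cosal.
- by rewrite (_ : (cos x - cos y) / 2 = - w) ?acosN// /w; field.
- by rewrite -ler_cos// cosal cos_norm /w; lra.
- by rewrite -ler_cos// cosal cosB /w; lra.
- move=> xy_lt.
  have cosxy' : - cos y < cos x by rewrite -cosB -(cos_norm x) ltr_cos//; lra.
  apply/andP; split.
  + by rewrite -ltr_cos// cosal cos_norm /w; lra.
  + by rewrite -ltr_cos// cosal cosB /w; lra.
Qed.

Lemma ent_lob_alpha (R : realType) (s t : R) : `|s| + `|t| <= 2 ->
  let x := pi * s / 2 in let y := pi * t / 2 in
  `|x| + `|y| <= pi /\
  ent s t = 1 / pi * lob_alpha x y (acos ((cos y - cos x) / 2)).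
Proof.
move=> st /=; have pi0 := @pi_gt0 R.
have xy : `|pi * s / 2| + `|pi * t / 2| <= pi.
  rewrite !normrM !(gtr0_norm pi0) (@gtr0_norm _ 2^-1)//.
  have : pi * (`|s| + `|t|) <= pi * 2 by rewrite ler_pM2l.
  lra.
split => //.
have [_ acosE _ _ _] := acos_half_bounds xy.
have pi_neq0 : (pi : R) != 0 by rewrite gt_eqF.
have scale (q r be : R) : q != 0 ->
    q * (r / 4 + 1 / (2 * q) * be) = (be + q * r / 2) / 2 by move=> ?; field.
rewrite /ent /lob_alpha /lob4 /p_a /p_b /p_c /p_d acosE !scale//.
by rewrite !mulrN !mulNr.
Qed.

(** Moving [s] away from [0] by half the radius of a ball inside the square raises |s| + |t| without
    leaving the square. *)
Lemma interior_diamond (R : realType) (s t : R) :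
  interior [set p : R * R | `|p.1| + `|p.2| <= 2] (s, t) -> `|s| + `|t| < 2.
Proof.
move=> /nbhs_ballP[e /= e0 sub].
pose s' := if 0 <= s then s + e / 2 else s - e / 2.
have s'E : `|s'| = `|s| + e / 2.
  rewrite /s'; case: (lerP 0 s) => s0.
    by rewrite ger0_norm ?(ger0_norm s0)//; lra.
  by rewrite ltr0_norm ?(ltr0_norm s0); lra.
have : `|s'| + `|t| <= 2.
  apply: (sub (s', t)); split => /=; last exact: ballxx.
  rewrite /ball/= /s'; case: ifP => _.
    by rewrite opprD addNKr normrN gtr0_norm; lra.
  by rewrite opprB addrCA subrr addr0 gtr0_norm; lra.
rewrite s'E; lra.
Qed.

Lemma angles_ge0 (R : realType) (x y al : R) : `|y| <= al -> al <= pi - `|x| ->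
  [/\ 0 <= al + y, 0 <= al - y, 0 <= pi - al - x & 0 <= pi - al + x].
Proof.
move=> + h; have : `|x| <= pi - al by lra.
by rewrite !ler_norml => /andP[? ?] /andP[? ?]; split; lra.
Qed.

Lemma angles_gt0 (R : realType) (x y al : R) : `|y| < al -> al < pi - `|x| ->
  [/\ 0 < al + y, 0 < al - y, 0 < pi - al - x & 0 < pi - al + x].
Proof.
move=> + h; have : `|x| < pi - al by lra.
by rewrite !ltr_norml => /andP[? ?] /andP[? ?]; split; lra.
Qed.

(** * Strict concavity of [ent] *)

Theorem theorem10p1 (R : realType) :
  strictly_concave_on [set p : R * R | `|p.1| + `|p.2| <= 2] (@ent R).
Proof.
move=> s1 t1 s2 t2 k /= A1 A2 k01.
set s := k * s1 + (1 - k) * s2; set t := k * t1 + (1 - k) * t2.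
have pi0 := @pi_gt0 R; have [k0 k1] := andP k01.
have k'0 : 0 < 1 - k by rewrite subr_gt0.
(* Convexity of the square, by the triangle inequality. *)
have st : `|s| + `|t| <= 2.
  have hs : `|s| <= k * `|s1| + (1 - k) * `|s2|.
    by rewrite (le_trans (ler_normD _ _))// !normrM (gtr0_norm k0) (gtr0_norm k'0).
  have ht : `|t| <= k * `|t1| + (1 - k) * `|t2|.
    by rewrite (le_trans (ler_normD _ _))// !normrM (gtr0_norm k0) (gtr0_norm k'0).
  have : k * (`|s1| + `|t1|) <= k * 2 by rewrite ler_pM2l.
  have : (1 - k) * (`|s2| + `|t2|) <= (1 - k) * 2 by rewrite ler_pM2l.
  lra.
have [xy1 ->] := ent_lob_alpha A1; have [xy2 ->] := ent_lob_alpha A2.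
have [xy ->] := ent_lob_alpha st.
have [_ _ lo1 hi1 _] := acos_half_bounds xy1.
have [_ _ lo2 hi2 _] := acos_half_bounds xy2.
have [cosbe _ lo hi in_be] := acos_half_bounds xy.
set al1 := acos _ in lo1 hi1 *; set al2 := acos _ in lo2 hi2 *.
set be := acos _ in cosbe lo hi in_be *.
set x1 := pi * s1 / 2 in xy1 hi1 *; set y1 := pi * t1 / 2 in xy1 lo1 *.
set x2 := pi * s2 / 2 in xy2 hi2 *; set y2 := pi * t2 / 2 in xy2 lo2 *.
set x := pi * s / 2 in xy hi cosbe in_be *; set y := pi * t / 2 in xy lo cosbe in_be *.
have [a1 b1 c1 d1] := angles_ge0 lo1 hi1.
have [a2 b2 c2 d2] := angles_ge0 lo2 hi2.
have [a0 b0 c0 d0] := angles_ge0 lo hi.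
have half (z : R) : 0 <= z -> 0 <= z / 2 by move=> ?; rewrite divr_ge0.
have sum (u v w : R) : (w + v) / 2 + (w - v) / 2 + (pi - w - u) / 2
   + (pi - w + u) / 2 = pi by field.
have [conc strict] := lob4_concave (half _ a1) (half _ b1) (half _ c1) (half _ d1)
  (sum x1 y1 al1) (half _ a2) (half _ b2) (half _ c2) (half _ d2) (sum x2 y2 al2) k01.
(* The averaged angle need not be the arccosine [be] at the averaged point; it is an admissible
   competitor. *)
pose al := k * al1 + (1 - k) * al2.
have aE : (al2 + y2) / 2 + k * ((al1 + y1) / 2 - (al2 + y2) / 2) = (al + y) / 2.
  by rewrite /al /y /y1 /y2 /t; field.
have bE : (al2 - y2) / 2 + k * ((al1 - y1) / 2 - (al2 - y2) / 2) = (al - y) / 2.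
  by rewrite /al /y /y1 /y2 /t; field.
have cE : (pi - al2 - x2) / 2 + k * ((pi - al1 - x1) / 2 - (pi - al2 - x2) / 2) =
    (pi - al - x) / 2.
  by rewrite /al /x /x1 /x2 /s; field.
have dE : (pi - al2 + x2) / 2 + k * ((pi - al1 + x1) / 2 - (pi - al2 + x2) / 2) =
    (pi - al + x) / 2.
  by rewrite /al /x /x1 /x2 /s; field.
rewrite aE bE cE dE -!/(lob_alpha _ _ _) in conc strict.
have conv (p q : R) : 0 <= p -> 0 <= q -> 0 <= k * p + (1 - k) * q.
  by move=> p0 q0; rewrite addr_ge0// mulr_ge0// ltW.
have al_a : 0 <= al + y.
  by rewrite (_ : _ + _ = k * (al1 + y1) + (1 - k) * (al2 + y2)) ?conv// /al /y /y1 /y2 /t; field.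
have al_b : 0 <= al - y.
  by rewrite (_ : _ - _ = k * (al1 - y1) + (1 - k) * (al2 - y2)) ?conv// /al /y /y1 /y2 /t; field.
have al_c : 0 <= pi - al - x.
  by rewrite (_ : _ - _ = k * (pi - al1 - x1) + (1 - k) * (pi - al2 - x2)) ?conv// /al /x /x1 /x2 /s; field.
have al_d : 0 <= pi - al + x.
  by rewrite (_ : _ + _ = k * (pi - al1 + x1) + (1 - k) * (pi - al2 + x2)) ?conv// /al /x /x1 /x2 /s; field.
have maxi : al != be -> lob_alpha x y al < lob_alpha x y be by exact: lob_alpha_lt.
have maxi_le : lob_alpha x y al <= lob_alpha x y be.
  by have [->//|/maxi/ltW] := eqVneq al be.
have ipi0 : 0 < 1 / pi :> R by rewrite divr_gt0.
rewrite !(mulrCA _ (1 / pi)) -mulrDr; split.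
  by rewrite ler_pM2l// (le_trans conc).
move=> neq /interior_diamond st_lt; rewrite ltr_pM2l//.
have [albe|/maxi] := eqVneq al be; last exact: le_lt_trans conc.
(* With [al = be], an interior point makes all four averaged angles positive. *)
have xy_lt : `|x| + `|y| < pi.
  rewrite /x /y !normrM !(gtr0_norm pi0) (@gtr0_norm _ 2^-1)//.
  have : pi * (`|s| + `|t|) < pi * 2 by rewrite ltr_pM2l.
  by clear; lra.
have /andP[be_lo be_hi] := in_be xy_lt.
have [a_gt0 b_gt0 c_gt0 d_gt0] := angles_gt0 be_lo be_hi.
rewrite -albe in a_gt0 b_gt0 c_gt0 d_gt0 *.
apply: strict; rewrite ?divr_gt0//.
(* If all four differences vanish, the last two give [s1 = s2] and the first two [t1 = t2]. *)
apply/negP => /eqP[e1 e2 e3 e4]; apply: neq.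
have ex : pi * (s1 - s2) = 0 by move: e3 e4; rewrite /x1 /x2; clear; lra.
have ey : pi * (t1 - t2) = 0 by move: e1 e2; rewrite /y1 /y2; clear; lra.
move/eqP: ex; rewrite mulf_eq0 gt_eqF//= subr_eq0 => /eqP ->.
by move/eqP: ey; rewrite mulf_eq0 gt_eqF//= subr_eq0 => /eqP ->.
Qed.
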